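(* There is an absolute constant $c>0$ such that for every $N\in\mathbb{N}$, if $\mathcal E$ is a random $N\times N$ matrix with independent random sign entries ($\pm1$ with probability $1/2$ each), then $$ \mathsf{P}\Bigl(\min_{\operatorname{rank}B\le cN}\|\mathcal E-B\|_{L_0^{N\times N}}\le c\Bigr)\le 2\exp(-cN^2). $$
   Context: The minimum is over real $N\times N$ matrices $B$ with $\operatorname{rank}B\le cN$. For a real $N\times N$ matrix $M$, $\|M\|_{L_0^{N\times N}}:=\max\{t\ge 0\colon\#\{(i,j)\colon|M_{i,j}|\ge t\}\ge tN^2\}$. *)

(* Defs.v *)
From HB Require Import structures.
From mathcomp Require Import all_boot all_order all_algebra.
From mathcomp Require Import all_classical all_reals all_analysis.
Set Implicit Arguments.
Unset Strict Implicit.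
Unset Printing Implicit Defensive.
Import Order.TTheory GRing.Theory Num.Theory.
Import numFieldNormedType.Exports.
Local Open Scope classical_set_scope.
Local Open Scope ring_scope.

Definition L0_levels (R : realType) (N : nat) (M : 'M[R]_N) : set R :=
  [set t | 0 <= t /\
     t * N%:R ^+ 2 <= #|[set ij : 'I_N * 'I_N | t <= `|M ij.1 ij.2|]%SET|%:R].

(* The supremum is a maximum as soon as N > 0, see L0normP. *)
Definition L0norm (R : realType) (N : nat) (M : 'M[R]_N) : R :=
  sup (L0_levels M).

Lemma L0normP (R : realType) (N : nat) (M : 'M[R]_N) : (0 < N)%N ->
  L0_levels M (L0norm M) /\ ubound (L0_levels M) (L0norm M).
Proof.
move=> N0; have NN0 : 0 < N%:R ^+ 2 :> R by rewrite exprn_gt0 // ltr0n.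
have S0 : L0_levels M 0 by split => //; rewrite mul0r ler0n.
have Sub : has_ubound (L0_levels M).
  exists 1 => t [_ ht]; rewrite -(ler_pM2r NN0) mul1r (le_trans ht)//.
  rewrite -natrX ler_nat (leq_trans (max_card _))//.
  by rewrite card_prod card_ord mulnn.
split; last exact: ub_le_sup.
rewrite /L0norm; set s := sup _.
have s0 : 0 <= s by apply: ub_le_sup.
split=> //; rewrite leNgt; apply/negP => lt_s.
have {}lt_s : #|[set ij : 'I_N * 'I_N | s <= `|M ij.1 ij.2|]%SET|%:R
    / N%:R ^+ 2 < s by rewrite ltr_pdivrMr.
set q := _ / _ in lt_s.
have q0 : 0 <= q by rewrite divr_ge0 ?ler0n// ltW.
pose m := \big[Num.max/q]_(ij : 'I_N * 'I_N | `|M ij.1 ij.2| < s) `|M ij.1 ij.2|.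
have ms : m < s by apply/bigmax_ltP; split.
have /(sup_adherent) : 0 < s - m by rewrite subr_gt0.
move=> /(_ _ (conj (ex_intro _ 0 S0) Sub)) [t [t0 ht]].
rewrite -/s opprB addrCA subrr addr0 => mt.
have qm : q <= m by apply: bigmax_ge_id.
have : t <= q.
  rewrite ler_pdivlMr// (le_trans ht)// ler_nat subset_leq_card//.
  apply/fintype.subsetP => ij; rewrite !finset.inE => tij; rewrite leNgt; apply/negP => ijs.
  by have := lt_le_trans mt tij; rewrite ltNge le_bigmax_cond.
by rewrite leNgt (le_lt_trans qm mt).
Qed.

(* The least L0 distance from M to the matrices of rank at most r. It is an
   infimum of a nonempty set of nonnegative reals; matrices of rank at most r
   whose distance to M is unrestricted on some entries need not form a closed
   set, so attainment is not built in. Where a minimum exists, this is it. *)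
Definition L0dist_rank (R : realType) (N : nat) (r : R) (M : 'M[R]_N) : R :=
  inf [set L0norm (M - B) | B in [set B : 'M[R]_N | (\rank B)%:R <= r]].

Lemma L0dist_rank_has_inf (R : realType) (N : nat) (r : R) (M : 'M[R]_N) :
  (0 < N)%N -> 0 <= r ->
  has_inf [set L0norm (M - B) | B in [set B : 'M[R]_N | (\rank B)%:R <= r]].
Proof.
move=> N0 r0; split; first by exists (L0norm (M - 0)), 0; rewrite //= mxrank0.
by exists 0 => _ [B _ <-]; have [[]] := L0normP (M - B) N0.
Qed.

Definition random_sign d (T : measurableType d) (R : realType)
    (P : probability T R) (X : {RV P >-> R}) : Prop :=
  [/\ forall w, X w = 1 \/ X w = -1,
      P [set w | X w = 1] = (2^-1)%:E
    & P [set w | X w = -1] = (2^-1)%:E].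

Definition mutually_independent d (T : measurableType d) (R : realType)
    (P : probability T R) (I : finType) (X : I -> {RV P >-> R}) : Prop :=
  forall (J : {set I}) (A : I -> set R),
    (forall i, measurable (A i)) ->
    P (\bigcap_(i in [set` J]) (X i @^-1` A i)) =
    (\prod_(i in J) P (X i @^-1` A i))%E.

Definition realization d (T : measurableType d) (R : realType)
    (P : probability T R) (N : nat) (X : 'I_N * 'I_N -> {RV P >-> R}) (w : T) :
    'M[R]_N :=
  \matrix_(i, j) X (i, j) w.

(* Random signs take finitely many values, so every event determined by the
   random matrix is measurable. *)
Lemma measurable_realization d (T : measurableType d) (R : realType)
    (P : probability T R) (N : nat) (X : 'I_N * 'I_N -> {RV P >-> R})
    (A : set 'M[R]_N) :
  (forall ij, random_sign (X ij)) ->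
  measurable [set w | A (realization X w)].
Proof.
move=> sX.
pose mx (f : {ffun 'I_N * 'I_N -> bool}) : 'M[R]_N :=
  \matrix_(i, j) (-1) ^+ f (i, j).
pose ev f : set T := \bigcap_(ij in [set: 'I_N * 'I_N])
   (X ij @^-1` [set (-1) ^+ (f : {ffun 'I_N * 'I_N -> bool}) ij]).
have mev f : measurable (ev f).
  apply: fin_bigcap_measurable; first exact: finite_finset.
  move=> ij _; rewrite -[X in measurable X]setTI.
  by apply: measurable_funP => //; exact: measurable_set1.
have -> : [set w | A (realization X w)] =
    \bigcup_(f in [set f | A (mx f)]) ev f.
  apply/seteqP; split=> [w /= Aw|w [f /= Af evw] /=].
    have evw : ev [ffun ij => X ij w == -1] w.
      move=> ij _ /=; rewrite ffunE; have [/(_ w) [] -> _ _] := sX ij.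
        by rewrite -subr_eq0 opprK -mulr2n pnatr_eq0.
      by rewrite eqxx.
    exists [ffun ij => X ij w == -1] => //=.
    by congr (A _) : Aw; apply/matrixP => i j; rewrite !mxE (evw (i, j)).
  by congr (A _) : Af; apply/matrixP => i j; rewrite !mxE (evw (i, j)).
by apply: fin_bigcup_measurable => //; exact: finite_finset.
Qed.

(* Main.v *)
Require Import Defs.
From HB Require Import structures.
From mathcomp Require Import all_boot all_order all_algebra.
From mathcomp Require Import all_classical all_reals all_analysis.
From mathcomp Require Import ring lra zify.
Set Implicit Arguments.
Unset Strict Implicit.
Unset Printing Implicit Defensive.
Import Order.TTheory GRing.Theory Num.Theory.
Import numFieldNormedType.Exports.
Local Open Scope classical_set_scope.
Local Open Scope ring_scope.

(** Write n for N ^ 2. The probability in question is at most 2 ^ - n times the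
    number of sign matrices E that agree, up to an error 1/2 and outside a small set of
    entries, with some matrix B of rank at most r, where r is a small multiple
    of N. The point is to show that there are at most (2 * 99/100) ^ n such E.
    The entries of B at the exceptional positions are not bounded, so these B
    have no finite net; a dimension argument takes its place.

    To a matrix b attach the Riesz product
      riesz b E = \prod_s (1 + (-1) ^+ E s * b s),
    a function of E on the cube of all sign matrices. Two facts compete.

    - Few dimensions. If b = U V^T with r inner indices, expanding the product
      shows that riesz b is a combination, with coefficients depending on U and
      V, of fixed functions indexed by the monomials in the entries of U and V
      whose degree in each row of U and in each row of V is at most N
      (riesz_bilinear_expansion). There are at most D of them, where D is
      exponentially small compared to 2 ^ n (card_row_column_low_degree), so
      all the functions riesz b lie in a fixed space of dimension at most D.

    - Concentration. The tensor product structure gives the norm of riesz b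
      exactly, and its value at the sign pattern of b is \prod_s (1 + |b s|).
      Since (1 + |t|) ^ 2 is at least 9/10 of 2 (1 + t ^ 2) for t near 1 or -1,
      and at least half of it for every t, however large, riesz b has a
      considerable part of its norm at the sign pattern of b
      (sign_pattern_concentration).

    A space of dimension D of functions on a finite set can concentrate only at
    few points: the leverage p x, which is the largest possible value of
    psi x ^ 2 / |psi| ^ 2 in this space, sums to at most D (leverage_scores).
    Therefore few sign patterns arise from B of low rank and with few bad
    entries. The matrix E differs from the sign pattern of B only at bad
    entries, which costs one more small exponential factor
    (card_near_bilinear). *)

(** * Leverage scores *)

Lemma sum_cauchy_schwarz (R : realFieldType) (I : finType) (a b : I -> R) :
  (\sum_i a i * b i) ^+ 2 <= (\sum_i a i ^+ 2) * (\sum_i b i ^+ 2).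
Proof.
have : 0 <= \sum_i \sum_j (a i * b j - a j * b i) ^+ 2.
  by apply: sumr_ge0 => i _; apply: sumr_ge0 => j _; exact: sqr_ge0.
have -> : \sum_i \sum_j (a i * b j - a j * b i) ^+ 2 =
    \sum_i \sum_j a i ^+ 2 * b j ^+ 2 + \sum_i \sum_j a j ^+ 2 * b i ^+ 2
    - 2 * \sum_i \sum_j (a i * b i) * (a j * b j).
  rewrite mulr_sumr -big_split/= -sumrB; apply: eq_bigr => i _.
  rewrite mulr_sumr -big_split/= -sumrB; apply: eq_bigr => j _.
  by ring.
rewrite [X in _ + X - _]exchange_big/= expr2 !big_distrlr/=; lra.
Qed.

Lemma row_free_gram_unit (R : realFieldType) (m n : nat) (A : 'M[R]_(m, n)) :
  row_free A -> A *m A^T \in unitmx.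
Proof.
move=> fA; rewrite -row_free_unit -kermx_eq0; apply/rowV0P => v /sub_kermxP vG.
have vA0 : v *m A = 0.
  have: \sum_j (v *m A) 0 j ^+ 2 = 0.
    transitivity ((v *m (A *m A^T) *m v^T) 0 0); last by rewrite vG mul0mx mxE.
    rewrite mulmxA -mulmxA -trmx_mul [RHS]mxE; apply: eq_bigr => j _.
    by rewrite [_^T _ _]mxE.
  move/eqP; rewrite psumr_eq0; last by move=> *; exact: sqr_ge0.
  move=> /allP h; apply/rowP => j; apply/eqP.
  by have := h j (mem_index_enum _); rewrite /= sqrf_eq0 !mxE.
by apply: (row_free_inj fA); rewrite vA0 mul0mx.
Qed.

(** The score p x is the diagonal entry at x of the orthogonal projection P onto
    the span of the functions w y. The trace of P is the dimension of the span,
    and psi x = <psi, P e_x> for psi in the span, so that Cauchy-Schwarz bounds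
    psi x by |psi| * |P e_x|, while |P e_x| ^ 2 = P x x. *)
Lemma leverage_scores (R : realFieldType) (I X : finType) (Y : {pred I})
    (w : I -> X -> R) :
  exists p : X -> R, [/\ forall x, 0 <= p x,
    \sum_x p x <= #|Y|%:R &
    forall mu : I -> R, let psi x := \sum_(y in Y) mu y * w y x in
      forall x, psi x ^+ 2 <= p x * \sum_z psi z ^+ 2].
Proof.
pose M : 'M[R]_(#|Y|, #|X|) := \matrix_(i, j) w (enum_val i) (enum_val j).
(* A basis of the span, so that its Gram matrix is invertible. *)
have [A Afree MA] : exists2 A : 'M[R]_(\rank M, #|X|), row_free A & (M <= A)%MS.
  by exists (row_base M); rewrite ?row_base_free ?eq_row_base.
pose G := A *m A^T.
have Gu : G \in unitmx by exact: row_free_gram_unit.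
pose P := A^T *m invmx G *m A.
have PT x y : P x y = P y x.
  suff /matrixP/(_ y x) : P^T = P by rewrite mxE.
  have GT : (invmx G)^T = invmx G by rewrite trmx_inv /G trmx_mul trmxK.
  by rewrite /P !trmx_mul trmxK GT mulmxA.
have AP : A *m P = A by rewrite /P !mulmxA mulmxV// mul1mx.
have PP : P *m P = P by rewrite {1}/P -mulmxA AP.
have PD x : P x x = \sum_z P z x ^+ 2.
  rewrite -{1}PP mxE; apply: eq_bigr => z _; rewrite expr2; congr (_ * _).
  exact: PT.
exists (fun x => P (enum_rank x) (enum_rank x)); split=> [x||mu psi x].
- by rewrite PD; apply: sumr_ge0 => z _; exact: sqr_ge0.
- have -> : \sum_x P (enum_rank x) (enum_rank x) = \tr P.
    by rewrite /mxtrace [RHS](reindex enum_rank)//; exact/onW_bij/enum_rank_bij.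
  rewrite /P mxtrace_mulC mulmxA mulmxV// mxtrace1 ler_nat.
  exact: rank_leq_row.
pose u : 'rV[R]_#|Y| := \row_i mu (enum_val i).
pose v := u *m M.
have vE z : v 0 (enum_rank z) = psi z.
  rewrite mxE /psi [RHS]big_enum_val; apply: eq_bigr => i _.
  by rewrite !mxE enum_rankK.
have vP : v *m P = v.
  have /submxP[D ->] : (v <= A)%MS by rewrite mulmx_sub.
  by rewrite -mulmxA AP.
rewrite -vE PD -[in X in X <= _]vP mxE mulrC.
have -> : \sum_z psi z ^+ 2 = \sum_j v 0 j ^+ 2.
  rewrite [RHS](reindex enum_rank); last exact/onW_bij/enum_rank_bij.
  by apply: eq_bigr => z _; rewrite vE.
exact: sum_cauchy_schwarz.
Qed.

(** * Riesz products of bilinear matrices *)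

Lemma prod_option_count (R : comPzSemiRingType) (J K : finType)
    (c : K -> R) (g : J -> option K) :
  \prod_j oapp c 1 (g j) = \prod_k c k ^+ #|[pred j | g j == Some k]|.
Proof.
under [RHS]eq_bigr do rewrite -prodr_const big_mkcond/=.
rewrite exchange_big/=; apply: eq_bigr => j _.
rewrite -big_mkcond/=; under [RHS]eq_bigl do rewrite inE.
case: (g j) => [k|]/=; last by rewrite big_pred0.
by rewrite (big_pred1 k)// => l; rewrite /= eq_sym.
Qed.

Lemma sum_option_count (J K : finType) (g : J -> option K) :
  (\sum_k #|[pred j | g j == Some k]| <= #|J|)%N.
Proof.
under eq_bigr do rewrite -sum1_card big_mkcond/=.
rewrite exchange_big/= -sum1_card; apply: leq_sum => j _.
rewrite -big_mkcond/=; under eq_bigl do rewrite inE.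
case: (g j) => [k|]/=; last by rewrite big_pred0.
by rewrite (big_pred1 k)// => l; rewrite /= eq_sym.
Qed.

Lemma prod_bool_distr (R : comPzSemiRingType) (Q : finType)
    (f : Q -> bool -> R) :
  \sum_(E : {ffun Q -> bool}) \prod_s f s (E s) =
  \prod_s (f s true + f s false).
Proof.
by rewrite -bigA_distr_bigA; apply: eq_bigr => s _; rewrite big_bool.
Qed.

Definition exponents (N r : nat) := {ffun 'I_r -> 'I_N.+1}.

Definition low_degree (N r : nat) : {pred exponents N r} :=
  [pred a : exponents N r | \sum_k a k <= N]%N.

Arguments low_degree : clear implicits.

(** Weighting every exponent vector a by y ^ (\sum_k a k) gives a product of
    truncated geometric series, each at most 1 / (1 - y), and every vector that
    is counted has weight at least y ^ N. *)
Lemma card_low_degree (R : realFieldType) (N r : nat) (y : R) :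
  0 < y -> y < 1 -> #|low_degree N r|%:R * (y ^+ N * (1 - y) ^+ r) <= 1.
Proof.
move=> y0 y1.
have geo : (1 - y) * \sum_(i < N.+1) y ^+ i <= 1.
  by rewrite -opprB mulNr -subrX1 opprB gerBl exprn_ge0// ltW.
have : #|low_degree N r|%:R * y ^+ N <= (\sum_(i < N.+1) y ^+ i) ^+ r.
  rewrite -[r in X in _ <= X]card_ord -prodr_const bigA_distr_bigA/=.
  rewrite -sumr_const mulr_suml [leLHS]big_mkcond/=; apply: ler_sum => a _.
  rewrite prodrXr; case: ifPn => [aN|_]; last by rewrite exprn_ge0// ltW.
  by rewrite mul1r ler_wiXn2l// ltW.
move=> /(@ler_wpM2r _ ((1 - y) ^+ r)); rewrite mulrA => h.
apply: (le_trans (h _)); first by rewrite exprn_ge0// subr_ge0 ltW.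
rewrite -exprMn; apply: exprn_ile1; last by rewrite mulrC.
apply: mulr_ge0; last by rewrite subr_ge0 ltW.
by apply: sumr_ge0 => i _; rewrite exprn_ge0// ltW.
Qed.

(** As a function of E, this is the tensor product over s of the vectors
    (1 + b s, 1 - b s). It is proportional to an indicator function when every
    |b s| is 1. *)
Definition riesz (R : pzRingType) (Q : finType) (b : Q -> R)
    (E : {ffun Q -> bool}) : R :=
  \prod_s (1 + (-1) ^+ E s * b s).

Lemma riesz_sqr_norm (R : comPzRingType) (Q : finType) (b : Q -> R) :
  \sum_E riesz b E ^+ 2 = \prod_s (2 * (1 + b s ^+ 2)).
Proof.
under [LHS]eq_bigr do rewrite /riesz -prodrXl.
rewrite (prod_bool_distr (fun s e => (1 + (-1) ^+ e * b s) ^+ 2)).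
by apply: eq_bigr => s _; rewrite expr1 expr0; ring.
Qed.

(** The first component gives, row by row, the exponents of the entries of a left
    factor U, and the second one those of a right factor V. *)
Definition monomials (N r : nat) : Type :=
  ({ffun 'I_N -> exponents N r} * {ffun 'I_N -> exponents N r})%type.
HB.instance Definition _ N r := Finite.on (monomials N r).

Definition row_column_low_degree (N r : nat) : {pred monomials N r} :=
  [predX ffun_on (low_degree N r) & ffun_on (low_degree N r)].

Arguments row_column_low_degree : clear implicits.

(** A term of the expanded product is given by a choice h of one summand at each
    position: None for 1, and Some k for +- U i k * V j k. Its dependence on U
    and V is a monomial in which U i k occurs as often as h takes the value
    Some k in row i, hence of degree at most N in row i of U, and likewise for
    V and the columns. Terms with the same monomial are collected. *)
Lemma riesz_bilinear_expansion (R : comPzRingType) (N r : nat) :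
  exists w : monomials N r -> {ffun 'I_N * 'I_N -> bool} -> R,
  forall U V : 'I_N -> 'I_r -> R, exists mu : monomials N r -> R, forall E,
  riesz (fun s => \sum_k U s.1 k * V s.2 k) E =
  \sum_(al in row_column_low_degree N r) mu al * w al E.
Proof.
(* The exponents are at most N, so inord does not truncate them. *)
pose rowexp (h : {ffun 'I_N * 'I_N -> option 'I_r}) :
    {ffun 'I_N -> exponents N r} :=
  [ffun i => [ffun k => inord #|[pred j | h (i, j) == Some k]|]].
pose colexp (h : {ffun 'I_N * 'I_N -> option 'I_r}) :
    {ffun 'I_N -> exponents N r} :=
  [ffun j => [ffun k => inord #|[pred i | h (i, j) == Some k]|]].
have inordE (p : pred 'I_N) : (inord #|p| : 'I_N.+1) = #|p| :> nat.
  by rewrite inordK// ltnS -[X in (_ <= X)%N]card_ord max_card.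
pose expo h : monomials N r := (rowexp h, colexp h).
pose sg (E : {ffun 'I_N * 'I_N -> bool}) h s : R :=
  oapp (fun _ : 'I_r => (-1) ^+ E s) 1
    ((h : {ffun 'I_N * 'I_N -> option 'I_r}) s).
exists (fun al E => \sum_(h | expo h == al) \prod_s sg E h s) => U V.
exists (fun al : monomials N r => (\prod_i \prod_k U i k ^+ al.1 i k) *
                  (\prod_j \prod_k V j k ^+ al.2 j k)) => E.
pose t (s : 'I_N * 'I_N) (o : option 'I_r) : R :=
  oapp (fun k => (-1) ^+ E s * (U s.1 k * V s.2 k)) 1 o.
have -> : riesz (fun s => \sum_k U s.1 k * V s.2 k) E = \prod_s \sum_o t s o.
  apply: eq_bigr => s _; rewrite (bigD1 None)//=; congr (_ + _).
  rewrite (reindex_omap Some id)/=; last by case.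
  rewrite mulr_sumr; apply: eq_big => [k|k _]//=.
  by rewrite eqxx.
rewrite bigA_distr_bigA/=.
rewrite (partition_big expo (mem (row_column_low_degree N r)))/=.
  apply: eq_bigr => al _; rewrite mulr_sumr; apply: eq_bigr => h /eqP <-.
  have -> : \prod_s t s (h s) = \prod_s (oapp (U s.1) 1 (h s) *
      oapp (V s.2) 1 (h s) * sg E h s).
    apply: eq_bigr => s _; rewrite /t /sg; case: (h s) => [k|]/=.
      by rewrite mulrC.
    by rewrite !mulr1.
  have pairE (F : 'I_N * 'I_N -> R) : \prod_s F s = \prod_i \prod_j F (i, j).
    by rewrite pair_bigA; apply: eq_bigr => -[].
  rewrite !big_split/=; congr (_ * _ * _).
    rewrite pairE; apply: eq_bigr => i _ /=.
    rewrite (prod_option_count (U i) (fun j => h (i, j))).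
    by apply: eq_bigr => k _; rewrite !ffunE inordE.
  rewrite pairE exchange_big/=; apply: eq_bigr => j _.
  rewrite (prod_option_count (V j) (fun i => h (i, j))).
  by apply: eq_bigr => k _; rewrite !ffunE inordE.
move=> h _; rewrite inE/=; apply/andP; split; apply/ffun_onP => i; rewrite inE/=.
  under eq_bigr do rewrite !ffunE inordE.
  by rewrite -[X in (_ <= X)%N]card_ord; exact: sum_option_count.
under eq_bigr do rewrite !ffunE inordE.
by rewrite -[X in (_ <= X)%N]card_ord; exact: sum_option_count.
Qed.

Lemma card_row_column_low_degree (R : realFieldType) (N r : nat) (y : R) :
  0 < y -> y < 1 ->
  #|row_column_low_degree N r|%:R * (y ^+ (2 * N ^ 2) * (1 - y) ^+ (2 * (r * N)))
    <= 1.
Proof.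
move=> y0 y1; rewrite cardX !card_ffun_on !card_ord -expnD addnn -mul2n natrX.
have -> : y ^+ (2 * N ^ 2) * (1 - y) ^+ (2 * (r * N)) =
    (y ^+ N * (1 - y) ^+ r) ^+ (2 * N).
  by rewrite exprMn -!exprM; congr (_ ^+ _ * _ ^+ _); rewrite ?expnS; lia.
rewrite -exprMn exprn_ile1 ?card_low_degree//.
by rewrite mulr_ge0// mulr_ge0// exprn_ge0 ?subr_ge0// ltW.
Qed.

(** * Concentration at the sign pattern *)

(** x to the power of the Hamming distance between E and E'. *)
Definition hamming_weight (R : comPzSemiRingType) (Q : finType) (x : R)
    (E E' : {ffun Q -> bool}) : R :=
  \prod_s (if E s == E' s then 1 else x).

Lemma sum_hamming_weight (R : comPzSemiRingType) (Q : finType) (x : R)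
    (E' : {ffun Q -> bool}) :
  \sum_E hamming_weight x E E' = (1 + x) ^+ #|Q|.
Proof.
rewrite (prod_bool_distr (fun s e => if e == E' s then 1 else x)) -prodr_const.
by apply: eq_bigr => s _; case: (E' s); rewrite //= addrC.
Qed.

Definition sign_pattern (R : numDomainType) (Q : finType) (b : Q -> R) :
    {ffun Q -> bool} :=
  [ffun s => b s < 0].

Lemma riesz_sign_pattern (R : realDomainType) (Q : finType) (b : Q -> R) :
  riesz b (sign_pattern b) = \prod_s (1 + `|b s|).
Proof.
apply: eq_bigr => s _; rewrite ffunE; case: ltP => b0.
  by rewrite ltr0_norm// expr1 mulN1r.
by rewrite ger0_norm// expr0 mul1r.
Qed.

Definition far (R : numFieldType) (Q : finType) (b : Q -> R)
    (E : {ffun Q -> bool}) : {pred Q} :=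
  [pred s | 2^-1 <= `|(-1) ^+ E s - b s|].

(** Both sides are products over the positions. At a position of far b E the
    right factor is at least 1/9 * 1/2 of 2 (1 + t ^ 2), where t = b s.
    Elsewhere t has the sign prescribed by E and 1/2 <= |t| <= 3/2, and then
    (1 + |t|) ^ 2 is at least 9/10 of 2 (1 + t ^ 2). *)
Lemma sign_pattern_concentration (R : realFieldType) (Q : finType)
    (b : Q -> R) (E : {ffun Q -> bool}) (K : nat) :
  (#|far b E| <= K)%N ->
  (9 / 10) ^+ #|Q| * (1 / 18) ^+ K * (\sum_E' riesz b E' ^+ 2) <=
  hamming_weight (1 / 9) E (sign_pattern b) * riesz b (sign_pattern b) ^+ 2.
Proof.
move=> farK; rewrite riesz_sqr_norm riesz_sign_pattern.
have /ler_wpM2r -/(_ ((9 / 10) ^+ #|Q| * \prod_s (2 * (1 + b s ^+ 2)))) :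
    (1 / 18) ^+ K <= \prod_s (if s \in far b E then 1 / 18 else 1) :> R.
  by rewrite -big_mkcond/= prodr_const ler_wiXn2l//; lra.
rewrite mulrA -[X in X * _ <= _]mulrC => h.
apply: le_trans (h _) _.
  apply: mulr_ge0; first by rewrite exprn_ge0//; lra.
  by apply: prodr_ge0 => s _; have := sqr_ge0 (b s); lra.
rewrite -prodr_const -prodrXl -!big_split/=; apply: ler_prod => s _.
rewrite !inE ffunE; set e := E s; set x := b s.
have x2 : `|x| ^+ 2 = x ^+ 2 by rewrite real_normK// num_real.
have x20 := sqr_ge0 x; have nx0 := normr_ge0 x.
have [farS|] := lerP 2^-1 `|(-1) ^+ e - x|.
  apply/andP; split; first by apply: mulr_ge0; lra.
  have : 1 / 9 <= (if e == (x < 0) then 1 else 1 / 9) :> R by case: ifP => _; lra.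
  move=> /(@ler_wpM2r _ ((1 + `|x|) ^+ 2) (sqr_ge0 _)); apply: le_trans.
  by rewrite -x2; nra.
rewrite ltr_distlC => /andP[lo hi].
have -> : e == (x < 0).
  by case: e lo hi; rewrite ?expr1 ?expr0 => lo hi; case: ltP => // x0; lra.
apply/andP; split; first by apply: mulr_ge0; lra.
have [n1 n2] : 1 / 2 <= `|x| /\ `|x| <= 3 / 2.
  case: e lo hi; rewrite ?expr1 ?expr0 => lo hi.
    by rewrite ltr0_norm; lra.
  by rewrite ger0_norm; lra.
by rewrite -x2; nra.
Qed.

(** Each E in F contributes at least (9/10) ^ n * (1/18) ^ K to the sum over all
    pairs (E, E') of hamming_weight (1/9) E E' * p E', where p is the leverage of
    the space of Riesz products: take for E' the sign pattern of the matrix near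
    E. Summing over E first, the total is (10/9) ^ n * \sum_E' p E'. *)
Lemma card_near_bilinear (R : realFieldType) (N r K : nat)
    (F : {pred {ffun 'I_N * 'I_N -> bool}}) :
  (forall E, E \in F -> exists U V : 'I_N -> 'I_r -> R,
     #|far (fun s => (\sum_k U s.1 k * V s.2 k)%R) E| <= K)%N ->
  #|F|%:R * ((9 / 10) ^+ (N ^ 2) * (1 / 18) ^+ K) <=
  (10 / 9) ^+ (N ^ 2) * #|row_column_low_degree N r|%:R :> R.
Proof.
move=> nearF; have [w wP] := riesz_bilinear_expansion R N r.
have [p [p0 psum pP]] := leverage_scores (row_column_low_degree N r) w.
have cardQ : #|{: 'I_N * 'I_N}| = (N ^ 2)%N by rewrite card_prod card_ord mulnn.
have hw0 E E' : 0 <= hamming_weight (1 / 9) E E' :> R.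
  by apply: prodr_ge0 => s _; case: ifP => _; lra.
apply: (@le_trans _ _ (\sum_(E in F) \sum_E' hamming_weight (1 / 9) E E' * p E')).
  rewrite -sumr_const mulr_suml; apply: ler_sum => E /nearF[U [V farK]].
  set b := fun s => _ in farK; rewrite mul1r.
  apply: (@le_trans _ _ (hamming_weight (1 / 9) E (sign_pattern b) *
                         p (sign_pattern b))); last first.
    rewrite [leRHS](bigD1 (sign_pattern b))//= lerDl sumr_ge0// => E' _.
    exact: mulr_ge0.
  have norm_gt0 : 0 < \sum_E' riesz b E' ^+ 2.
    rewrite riesz_sqr_norm prodr_gt0// => s _.
    by have := sqr_ge0 (b s); lra.
  rewrite -(ler_pM2r norm_gt0) -cardQ.
  apply: le_trans (sign_pattern_concentration farK) _.
  rewrite -mulrA ler_wpM2l//.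
  have [mu muP] := wP U V; have := pP mu (sign_pattern b).
  rewrite /= -muP; under eq_bigr do rewrite -muP.
  by [].
apply: (@le_trans _ _ (\sum_E \sum_E' hamming_weight (1 / 9) E E' * p E')).
  rewrite [leLHS]big_mkcond/=; apply: ler_sum => E _; case: ifP => // _.
  by apply: sumr_ge0 => E' _; exact: mulr_ge0.
rewrite exchange_big/=.
under eq_bigr do rewrite -mulr_suml sum_hamming_weight cardQ.
rewrite -mulr_sumr; apply: ler_pM => //.
  exact: sumr_ge0.
by rewrite lerXn2r// ?nnegrE; lra.
Qed.

(** * Counting the sign matrices near low rank *)

Lemma rank_le_bilinear (F : fieldType) (N r : nat) (B : 'M[F]_N) :
  (\rank B <= r)%N ->
  exists U V : 'I_N -> 'I_r -> F, forall s : 'I_N * 'I_N,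
    B s.1 s.2 = \sum_k U s.1 k * V s.2 k.
Proof.
move=> rB.
pose U := col_base B *m (pid_mx (\rank B) : 'M[F]_(_, r)).
pose V := (pid_mx (\rank B) : 'M[F]_(r, _)) *m row_base B.
have <- : U *m V = B.
  by rewrite mulmxA -(mulmxA (col_base B)) pid_mx_id// pid_mx_1 mulmx1 mulmx_base.
by exists (fun i k => U i k), (fun j k => V k j) => s; rewrite [LHS]mxE.
Qed.

(** The previous bounds, with y = 9/10 in the dimension count, give
    #|F| <= (10/9) ^ (4 n) * 18 ^ K * 100 ^ (r * N). As 50 K <= n and
    100 r N <= n, the last two factors are at most (11/10) ^ n each, and
    (10/9) ^ 4 * (11/10) ^ 2 < 2 * 99/100. *)
Lemma card_near_low_rank (R : realFieldType) (N : nat)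
    (F : {pred {ffun 'I_N * 'I_N -> bool}}) :
  (forall E, E \in F -> exists B : 'M[R]_N, (100 * \rank B <= N)%N /\
     (50 * #|far (fun s => B s.1 s.2) E| <= N ^ 2)%N) ->
  #|F|%:R <= (2 * (99 / 100)) ^+ (N ^ 2) :> R.
Proof.
move=> nearF; pose r := (N %/ 100)%N; pose K := (N ^ 2 %/ 50)%N.
have Kn : (50 * K <= N ^ 2)%N by rewrite mulnC leq_divM.
have rn : (100 * (r * N) <= N ^ 2)%N.
  by rewrite mulnA -mulnn leq_mul2r mulnC leq_divM orbT.
have nearUV E : E \in F -> exists U V : 'I_N -> 'I_r -> R,
    (#|far (fun s => (\sum_k U s.1 k * V s.2 k)%R) E| <= K)%N.
  move=> /nearF[B [rB farB]].
  have /rank_le_bilinear[U [V BUV]] : (\rank B <= r)%N.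
    by rewrite leq_divRL// mulnC.
  exists U, V; rewrite leq_divRL// mulnC; apply: leq_trans farB.
  by rewrite leq_mul2l/=; apply/eq_leq/eq_card => s; rewrite !inE BUV.
have cardF := card_near_bilinear nearUV.
have cardD : #|row_column_low_degree N r|%:R *
    ((9 / 10) ^+ (2 * N ^ 2) * (1 - 9 / 10) ^+ (2 * (r * N))) <= 1 :> R.
  by apply: card_row_column_low_degree; lra.
move: (N ^ 2)%N Kn rn cardF cardD => n Kn rn cardF cardD.
(* (10/11) ^ 10 <= 1/2 turns 18 < 2 ^ 5 and 100 < 2 ^ 10 into the two bounds. *)
have absorb (a : R) (i j : nat) :
    2^-1 ^+ i <= a -> (10 * i * j <= n)%N -> (10 / 11) ^+ n <= a ^+ j.
  move=> ia ijn; apply: (@le_trans _ _ ((10 / 11) ^+ (10 * i * j))).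
    by rewrite ler_wiXn2l//; lra.
  have q0 : 0 <= (10 / 11) ^+ 10 :> R by rewrite exprn_ge0//; lra.
  rewrite !exprM; apply: lerXn2r; rewrite ?nnegrE ?exprn_ge0//.
    by apply: le_trans ia; rewrite exprn_ge0//; lra.
  apply: le_trans ia; apply: lerXn2r; rewrite ?nnegrE//; lra.
have farq : (10 / 11) ^+ n <= (1 / 18) ^+ K :> R.
  by apply: (absorb _ 5%N) => //; rewrite !exprS expr0; lra.
have rankq : (10 / 11) ^+ n <= (1 - 9 / 10) ^+ (2 * (r * N)) :> R.
  by rewrite exprM; apply: (absorb _ 10%N) => //; rewrite !exprS expr0; lra.
move: cardD farq rankq cardF; rewrite (mulnC 2) exprM.
move: (_ ^+ (2 * (r * N))) ((1 / 18) ^+ K) => h k.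
have ge1 : 1 <= (2 * (99 / 100)) ^+ n *
    ((9 / 10) ^+ n ^+ 4 * (10 / 11) ^+ n ^+ 2) :> R.
  rewrite -!exprM !(mulnC n) !exprM -!exprMn exprn_ege1//.
  by rewrite !exprS expr0; lra.
have ab : (9 / 10) ^+ n * (10 / 9) ^+ n = 1 :> R.
  by rewrite -exprMn (_ : _ * _ = 1) ?expr1n//; lra.
have a0 : 0 <= (9 / 10) ^+ n :> R by rewrite exprn_ge0//; lra.
have b0 : 0 <= (10 / 9) ^+ n :> R by rewrite exprn_ge0//; lra.
have q0 : 0 <= (10 / 11) ^+ n :> R by rewrite exprn_ge0//; lra.
have z0 : 0 <= (2 * (99 / 100)) ^+ n :> R by rewrite exprn_ge0//; lra.
have D0 := ler0n R #|row_column_low_degree N r|.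
have M0 := ler0n R #|F|.
move: ((2 * (99 / 100)) ^+ n) ((9 / 10) ^+ n) ((10 / 9) ^+ n) ((10 / 11) ^+ n)
  #|row_column_low_degree N r|%:R #|F|%:R a0 b0 q0 z0 ab ge1 D0 M0.
move=> z a b q D M a0 b0 q0 z0 ab ge1 D0 M0 cardD farq rankq cardF.
have {}cardF : M * (a * q) <= b * D.
  by apply: le_trans cardF; rewrite ler_wpM2l// ler_wpM2l.
have {}cardD : D * (a ^+ 2 * q) <= 1.
  by apply: le_trans cardD; rewrite ler_wpM2l// ler_wpM2l// sqr_ge0.
have Ma : M * (a * q) * (a ^+ 3 * q) <= 1.
  apply: (@le_trans _ _ (b * D * (a ^+ 3 * q))).
    by rewrite ler_wpM2r// mulr_ge0// exprn_ge0.
  apply: le_trans cardD; rewrite le_eqVlt; apply/orP; left; apply/eqP.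
  by rewrite -[RHS]mul1r -ab; ring.
apply: (@le_trans _ _ (M * (z * (a ^+ 4 * q ^+ 2)))).
  by rewrite -[leLHS]mulr1 ler_wpM2l.
have -> : M * (z * (a ^+ 4 * q ^+ 2)) = z * (M * (a * q) * (a ^+ 3 * q)) by ring.
by rewrite -[leRHS]mulr1 ler_wpM2l.
Qed.

(** * The random sign matrix *)

Definition sign_matrix (R : pzRingType) (N : nat)
    (E : {ffun 'I_N * 'I_N -> bool}) : 'M[R]_N :=
  \matrix_(i, j) (-1) ^+ E (i, j).

(** The infimum need not be attained, but some B has L0 distance below
    1/100 + 1/100 = 1/50 to E; then 1/50 is not a level of their difference, so
    fewer than N ^ 2 / 50 of its entries reach 1/50, let alone 1/2. *)
Lemma L0dist_rank_near (R : realType) (N : nat) (E : {ffun 'I_N * 'I_N -> bool}) :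
  (0 < N)%N -> L0dist_rank (1 / 100 * N%:R) (sign_matrix R E) <= 1 / 100 ->
  exists B : 'M[R]_N, (100 * \rank B <= N)%N /\
    (50 * #|far (fun s => B s.1 s.2) E| <= N ^ 2)%N.
Proof.
move=> N0 distE.
have c0 : 0 < 1 / 100 :> R by lra.
have r0 : 0 <= 1 / 100 * N%:R :> R by rewrite mulr_ge0 ?ler0n// ltW.
have [_ [B rB <-] near] :=
  inf_adherent c0 (L0dist_rank_has_inf (sign_matrix R E) N0 r0).
exists B; split.
  by rewrite -(ler_nat R) natrM; move: rB => /=; lra.
have [_ ub] := L0normP (sign_matrix R E - B) N0.
rewrite leqNgt; apply/negP => many.
suff /ub : L0_levels (sign_matrix R E - B) (1 / 50).
  by move: near distE; rewrite /L0dist_rank; lra.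
split; first lra.
have : (#|far (fun s => B s.1 s.2) E| <=
   #|[set ij : 'I_N * 'I_N |
       (1 / 50 <= `|(sign_matrix R E - B) ij.1 ij.2|)%R]%SET|)%N.
  apply/subset_leq_card/fintype.subsetP => -[i j].
  by rewrite !finset.inE !mxE/=; apply: le_trans; lra.
move=> /(leq_mul (leqnn 50))/(leq_trans many)/ltnW.
by rewrite -(ler_nat R) natrM natrX; lra.
Qed.

Lemma probability_bigsetU_le d (T : measurableType d) (R : realType)
    (P : probability T R) (I : finType) (F : {pred I}) (A : I -> set T) :
  (forall i, measurable (A i)) ->
  (P (\big[setU/set0]_(i in F) A i) <= \sum_(i in F) P (A i))%E.
Proof.
move=> mA.
suff [] : measurable (\big[setU/set0]_(i in F) A i) /\
  (P (\big[setU/set0]_(i in F) A i) <= \sum_(i in F) P (A i))%E by [].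
elim/big_rec2: _ => [|i y B _ [mB PB]]; first by rewrite measure0.
split; first exact: measurableU.
by apply: le_trans (measureU2 _ (mA i) mB) _; rewrite leeD2l.
Qed.

Lemma probability_sign_outcome d (T : measurableType d) (R : realType)
    (P : probability T R) (Q : finType) (X : Q -> {RV P >-> R})
    (E : {ffun Q -> bool}) :
  (forall s, random_sign (X s)) -> mutually_independent X ->
  P (\bigcap_(s in [set` [set: Q]%SET]) (X s @^-1` [set (-1) ^+ E s])) =
  ((2^-1) ^+ #|Q|)%:E.
Proof.
move=> sX indX; rewrite indX; last by move=> s; exact: measurable_set1.
rewrite (eq_bigr (fun _ => (2^-1)%:E)) => [|s _].
  by rewrite prodEFin prodr_const cardsT.
by have [_ P1 PN1] := sX s; case: (E s); [exact: PN1|exact: P1].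
Qed.

Theorem mainTheorem12 (R : realType) :
  exists c : R, 0 < c /\
    forall (N : nat), (0 < N)%N ->
    forall (d : measure_display) (T : measurableType d) (P : probability T R)
           (X : 'I_N * 'I_N -> {RV P >-> R}),
      (forall ij, random_sign (X ij)) ->
      mutually_independent X ->
      (P [set w | (L0dist_rank (c * N%:R) (realization X w) <= c)%R]
         <= (2 * expR (- (c * N%:R ^+ 2)))%:E)%E.
Proof.
exists (1 / 100); split=> [|N N0 d T P X sX indX]; first lra.
pose F : {pred {ffun 'I_N * 'I_N -> bool}} :=
  [pred E | `[< L0dist_rank (1 / 100 * N%:R) (sign_matrix R E) <= 1 / 100 >]].
pose A (E : {ffun 'I_N * 'I_N -> bool}) :=
  \bigcap_(s in [set` [set: 'I_N * 'I_N]%SET]) (X s @^-1` [set (-1) ^+ E s]).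
have mA E : measurable (A E).
  apply: fin_bigcap_measurable; first exact: finite_finset.
  move=> s _; rewrite -[X in measurable X]setTI.
  by apply: measurable_funP => //; exact: measurable_set1.
have cardF : #|F|%:R <= (2 * (99 / 100)) ^+ (N ^ 2) :> R.
  by apply: card_near_low_rank => E /asboolP; exact: L0dist_rank_near.
apply: (@le_trans _ _ (P (\big[setU/set0]_(E in F) A E))).
  apply: le_measure; rewrite ?inE//.
  - exact: (measurable_realization (fun M => L0dist_rank _ M <= _)).
  - by apply: bigsetU_measurable.
  move=> w /= distw; pose E := [ffun s => X s w == -1].
  have XE s : X s w = (-1) ^+ E s.
    rewrite ffunE; have [/(_ w)[] -> _ _] := sX s; last by rewrite eqxx.
    by rewrite -subr_eq0 opprK -mulr2n pnatr_eq0.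
  have EF : E \in F.
    apply/asboolP; rewrite (_ : sign_matrix R E = realization X w)//.
    by apply/matrixP => i j; rewrite !mxE XE.
  by rewrite (bigD1 E)//=; left => s _ /=; rewrite XE.
apply: le_trans (probability_bigsetU_le _ _ mA) _.
under eq_bigr do rewrite probability_sign_outcome//.
rewrite sumEFin lee_fin sumr_const card_prod card_ord mulnn -[leLHS]mulr_natl.
apply: (@le_trans _ _ ((99 / 100) ^+ (N ^ 2))).
  rewrite (_ : 99 / 100 = (2 * (99 / 100)) * 2^-1); last lra.
  by rewrite [leRHS]exprMn ler_wpM2r// exprn_ge0//; lra.
rewrite -natrX -mulNr [X in expR X]mulrC expRM_natl.
have e0 : 99 / 100 <= expR (- (1 / 100)) :> R.
  by apply: le_trans (expR_ge1Dx _); lra.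
apply: (@le_trans _ _ (expR (- (1 / 100)) ^+ (N ^ 2))).
  by apply: lerXn2r; rewrite ?nnegrE ?expR_ge0//; lra.
by rewrite ler_peMl ?exprn_ge0 ?expR_ge0//; lra.
Qed.
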